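(* For every $n\ge 1$ and all $k,j\in\{0,1,\dots,n-1\}$, $$\mathcal{E}(n,k,j)=\frac{n!}{2^{k+j}}\binom{k+j}{k}\,\mathcal{D}(n,k+j).$$
   Context: A partition of $[2n]=\{1,\dots,2n\}$ is non-crossing if there are no $k<m<k'<m'$ with $k,k'$ in one block and $m,m'$ in a different block. For distinct blocks $B,B'$ of a non-crossing partition write $B<B'$ ($B'$ is inner with respect to $B$) if there are $a,b\in B$ with $a<c<b$ for all $c\in B'$; write $B\prec B'$ if $B<B'$ and there is no block $B''$ with $B<B''<B'$. A block $B'$ is an inner block of the partition if $B<B'$ for some block $B$. $\mathcal{NC}_{2n}^2$ is the set of non-crossing partitions of $[2n]$ all of whose blocks have two elements. $\mathcal{ONC}_{2n}^2$ is the set of sequences $P=(P_1,\dots,P_n)$ listing all blocks of some element of $\mathcal{NC}_{2n}^2$, each exactly once, in an arbitrary order. For $P\in\mathcal{ONC}_{2n}^2$, $e(P)$ (number of disorders) is the number of pairs $i<j$ with $P_j\prec P_i$ and $e'(P)$ (number of orders) is the number of pairs $i<j$ with $P_i\prec P_j$. The generalized Euler number is $\mathcal{E}(n,k,j)=|\{P\in\mathcal{ONC}_{2n}^2: e(P)=k,\ e'(P)=j\}|$. The Delaney number $\mathcal{D}(n,l)$ is the number of $\pi\in\mathcal{NC}_{2n}^2$ having exactly $l$ inner blocks (so $\mathcal{D}(n,l)=0$ for $l\ge n$); for $0\le l\le n-1$ one has $\mathcal{D}(n,l)=\binom{n+l-1}{l}-\binom{n+l-1}{l-1}$, with $\binom{m}{-1}=0$.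 *)

(* Defs.v *)
From mathcomp Require Import all_boot.

Set Implicit Arguments.
Unset Strict Implicit.
Unset Printing Implicit Defensive.

Section Blocks.

(* The ground set [N] = {1, ..., N} is represented by 'I_N = {0, ..., N-1};
   only the order of its elements matters. *)
Variable N : nat.
Implicit Types (B : {set 'I_N}) (pi : {set {set 'I_N}}).

Definition noncrossing pi : bool :=
  [forall B in pi, forall B' in pi, (B != B') ==>
    ~~ [exists k in B, exists m in B', exists k' in B, exists m' in B',
          [&& k < m, m < k' & k' < m']]].

Definition block_lt B B' : bool :=
  (B != B') && [exists a in B, exists b in B, forall c in B', a < c < b].

Definition block_cover pi B B' : bool :=
  block_lt B B' && ~~ [exists B'' in pi, block_lt B B'' && block_lt B'' B'].

Definition inner_blocks pi : {set {set 'I_N}} :=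
  [set B' in pi | [exists B in pi, block_lt B B']].

End Blocks.

Definition NC2 (n : nat) : {set {set {set 'I_(2 * n)}}} :=
  [set pi | [&& partition pi [set: 'I_(2 * n)], noncrossing pi
              & [forall B in pi, #|B| == 2]]].

Definition ONC2 (n : nat) : {set n.-tuple {set 'I_(2 * n)}} :=
  [set P : n.-tuple {set 'I_(2 * n)} | uniq P && ([set B in P] \in NC2 n)].

Definition disorders (n : nat) (P : n.-tuple {set 'I_(2 * n)}) : nat :=
  #|[set ij : 'I_n * 'I_n | (ij.1 < ij.2) &&
      block_cover [set B in P] (tnth P ij.2) (tnth P ij.1)]|.

Definition orders (n : nat) (P : n.-tuple {set 'I_(2 * n)}) : nat :=
  #|[set ij : 'I_n * 'I_n | (ij.1 < ij.2) &&
      block_cover [set B in P] (tnth P ij.1) (tnth P ij.2)]|.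

Definition euler_number (n k j : nat) : nat :=
  #|[set P in ONC2 n | (disorders P == k) && (orders P == j)]|.

Definition delaney_number (n l : nat) : nat :=
  #|[set pi in NC2 n | #|inner_blocks pi| == l]|.

(* Main.v *)
Require Import Defs.
From HB Require Import structures.
From mathcomp Require Import all_boot all_order all_algebra.
From mathcomp Require Import zify ring.

(** An ordered non-crossing pairing of [2n] is the same thing as a plane forest
    on n vertices carrying the labels 0, ..., n-1: the vertices are the blocks,
    the label of a block is its place in the list P, and the edges are the
    covering pairs of blocks.  A forest has as many edges as the pairing has
    inner blocks, an edge counts for e'(P) when the parent has the smaller
    label and for e(P) when it has the larger one.  The formula therefore says
    that, among the labelled plane forests with l edges, the l comparisons
    along the edges behave on the whole like l independent fair coins.

    This is false for a single forest shape: in a vertex with two children the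
    three possible numbers of ascents are equally frequent, while for a chain
    of three vertices they have frequencies 1, 4, 1.  It becomes true after
    summation over all shapes, by the following symmetry.  Cutting the edge
    from the root a of a tree to its first child b leaves two trees, one rooted
    at b and one rooted at a, and any ordered pair of trees arises from exactly
    one tree in this way.  Exchanging the two trees of the pair reverses the
    comparison of a with b and affects no other edge.  So, giving weight x to
    an ascent and y to a descent, the cut edge contributes (x + y) / 2 on
    average, and the two smaller trees can be treated by induction.  The
    induction runs over all trees at once, with an arbitrary factor that
    depends only on the multiset of labels used ([sum_tree_weights],
    [sum_forest_weights]); taking for that factor the indicator of each label
    being used exactly once restricts the sum to the forests of interest.

    The dictionary between forests and pairings goes through words: the word of
    a forest lists, position by position, the label of the block covering that
    position.  It is the traversal a u a v of a forest whose first tree has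
    root a and subforest u and whose other trees form v.  The blocks of this
    word form a non-crossing pairing ([matching_ONC2]) whose covering pairs are
    the edges ([block_coverE]), and every ordered non-crossing pairing arises
    exactly once ([perm_matchings]).  Finally each pairing of [2n] has n! orderings, so
    that n! D(n,l) labelled forests have l edges ([card_ONC2_inner]), and the
    formula is read off from the coefficients of ((1 + X) / 2) ^ l. *)

Set Implicit Arguments.
Unset Strict Implicit.
Unset Printing Implicit Defensive.

(** * Labelled plane forests *)

(** A forest is either empty or given by the root label of its first tree, the
    forest of subtrees below that root, and the forest of the other trees. *)
Inductive forest (L : Type) := Empty | Node of L & forest L & forest L.
Arguments Empty {L}.

Section ForestEq.
Variable L : Type.

(** An encoding into generic trees, from which forests get decidable equality. *)
Fixpoint forest_code (u : forest L) : GenTree.tree L :=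
  if u is Node a u1 u2 then
    GenTree.Node 0 [:: GenTree.Leaf a; forest_code u1; forest_code u2]
  else GenTree.Node 0 [::].

Fixpoint forest_decode (t : GenTree.tree L) : option (forest L) :=
  match t with
  | GenTree.Node _ [:: GenTree.Leaf a; t1; t2] =>
      if (forest_decode t1, forest_decode t2) is (Some u1, Some u2)
      then Some (Node a u1 u2) else None
  | _ => Some Empty
  end.

Lemma forest_codeK : pcancel forest_code forest_decode.
Proof. by elim=> //= a u1 -> u2 ->. Qed.
End ForestEq.

HB.instance Definition _ (L : eqType) :=
  Equality.copy (forest L) (pcan_type (@forest_codeK L)).

Section Forest.
Variable L : Type.
Implicit Types (a b : L) (p : option L) (u v : forest L).

Fixpoint labels u : seq L :=
  if u is Node a u1 u2 then a :: labels u1 ++ labels u2 else [::].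

Fixpoint root_labels u : seq L :=
  if u is Node a u1 u2 then a :: root_labels u2 else [::].

Fixpoint word u : seq L :=
  if u is Node a u1 u2 then a :: word u1 ++ a :: word u2 else [::].

(** The pairs (parent, child); p is the label of a vertex, if any, to which the
    roots of u are attached, so that edges None u are the edges of u itself. *)
Fixpoint edges p u : seq (L * L) :=
  if u is Node b u1 u2 then
    (if p is Some a then [:: (a, b)] else [::])
      ++ edges (Some b) u1 ++ edges p u2
  else [::].

Lemma size_word u : size (word u) = (size (labels u)).*2.
Proof.
elim: u => //= a u1 IH1 u2 IH2.
rewrite !size_cat /= IH1 IH2; lia.
Qed.

(** Below a vertex every label is the end of exactly one edge, and depth-first
    order is used on both sides. *)
Lemma targets_child a u : [seq e.2 | e <- edges (Some a) u] = labels u.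
Proof. by elim: u a => //= b u1 IH1 u2 IH2 a; rewrite map_cat IH1 IH2. Qed.

Lemma size_edges_child a u : size (edges (Some a) u) = size (labels u).
Proof. by rewrite -(targets_child a) size_map. Qed.

End Forest.

(** * Words of forests and nesting of labels *)

Section Nesting.
Variable L : eqType.
Implicit Types (a b i j : L) (u v : forest L).

Lemma uniq_labels_Node a u v :
  uniq (labels (Node a u v)) =
    [&& a \notin labels u, a \notin labels v, uniq (labels u), uniq (labels v)
      & ~~ has (mem (labels u)) (labels v)].
Proof. rewrite /= cat_uniq mem_cat negb_or -!andbA; do !bool_congr. Qed.

Lemma labels_disjoint u v i :
  ~~ has (mem (labels u)) (labels v) -> i \in labels u -> i \in labels v -> False.
Proof. by move/hasPn=> H Hu /H; rewrite /= Hu. Qed.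

Lemma mem_word u : word u =i labels u.
Proof.
elim: u => //= a u IHu v IHv i; rewrite !inE !mem_cat !inE IHu IHv.
by case: (i == a); rewrite ?orbT.
Qed.

Lemma count_word u i : count_mem i (word u) = (count_mem i (labels u)).*2.
Proof. by elim: u => //= a u IHu v IHv; rewrite !count_cat /= IHu IHv; lia. Qed.

(** The second occurrence of the first letter marks where the subforest of the
    first root ends; it can be recognised because that label is not reused. *)
Lemma word_inj_uniq u v : uniq (labels u) -> word u = word v -> u = v.
Proof.
elim: u v => [|a u1 IH1 u2 IH2] [|b v1 v2] //.
rewrite uniq_labels_Node => /and5P[au1 au2 uu1 uu2 _] [<-{b} E].
have /= cnt := congr1 (count_mem a) E.
have av1 : a \notin labels v1.
  apply/negP => Hv1; move: cnt.
  rewrite !count_cat /= eqxx !count_word.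
  have /count_memPn -> := au1; have /count_memPn -> := au2.
  have : 0 < count_mem a (labels v1) by rewrite -has_count has_pred1.
  lia.
have Hs : size (word u1) = size (word v1).
  have := congr1 (index a) E.
  rewrite !index_cat !mem_word (negPf au1) (negPf av1) /= eqxx; lia.
move/eqP: E; rewrite eqseq_cat // => /andP[/eqP E1 /eqP[E2]].
by rewrite (IH1 v1) // (IH2 v2).
Qed.

(** The strict descendant relation between labels. *)
Fixpoint nested u i j : bool :=
  if u is Node a u1 u2 then
    [|| (i == a) && (j \in labels u1), nested u1 i j | nested u2 i j]
  else false.

Lemma nested_labels u i j :
  nested u i j -> (i \in labels u) /\ (j \in labels u).
Proof.
elim: u => //= a u1 IH1 u2 IH2; rewrite !inE !mem_cat.
case/or3P => [/andP[-> ->]|/IH1[-> ->]|/IH2[-> ->]]; by rewrite ?orbT.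
Qed.

Lemma mem_edges_child a u i j :
  ((i, j) \in edges (Some a) u) =
    (i == a) && (j \in root_labels u) || ((i, j) \in edges None u).
Proof.
elim: u => [|b u1 _ u2 IH2] /=; first by rewrite andbF.
rewrite !inE !mem_cat IH2 xpair_eqE.
by do !case: (_ \in _) => //=; do !case: (_ == _).
Qed.

(** In terms of nesting: below a root a, the labels covered by a are those
    that are nested in no other label. *)
Lemma mem_root_labels u j : uniq (labels u) ->
  j \in root_labels u <-> j \in labels u /\ forall k, ~~ nested u k j.
Proof.
elim: u => [_|a u1 _ u2 IH2]; first by split=> // -[].
rewrite uniq_labels_Node => /and5P[a1 a2 _ uu2 dis]; rewrite /= !inE mem_cat.
split.
  case/orP => [/eqP ->|/(IH2 uu2)[j2 Hj]].
    rewrite eqxx; split=> // k; rewrite (negPf a1) andbF /=.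
    apply/norP; split; apply/negP => /nested_labels[_].
      by rewrite (negPf a1).
    by rewrite (negPf a2).
  rewrite j2 !orbT; split=> // k; rewrite (negPf (Hj k)) orbF.
  apply/norP; split; apply/negP; [move=> /andP[_ j1]|move=> /nested_labels[_ j1]];
    exact: labels_disjoint dis j1 j2.
case=> /or3P[->|j1|j2] // Hk; first by have := Hk a; rewrite eqxx j1.
apply/orP; right; apply/(IH2 uu2); split=> // k.
by have := Hk k; rewrite !negb_or => /and3P[].
Qed.

(** Nesting is ancestry, so one label covers another exactly when it is its
    parent.  For a forest with first root a, the only new edges go from a to
    the roots of its subforest, which is why [mem_root_labels] is needed. *)
Lemma mem_edges u i j : uniq (labels u) ->
  (i, j) \in edges None u <->
    nested u i j /\ forall k, ~~ (nested u i k && nested u k j).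
Proof.
elim: u => [_|a u1 IH1 u2 IH2]; first by split=> // -[].
rewrite uniq_labels_Node => /and5P[a1 a2 uu1 uu2 dis].
(* na, na2, n1, n2: a lies in neither subforest, and nesting never relates a
   label of one subforest with anything in the other. *)
have na x : nested u1 a x = false.
  by apply/negP => /nested_labels[]; rewrite (negPf a1).
have na2 x : nested u2 a x = false.
  by apply/negP => /nested_labels[]; rewrite (negPf a2).
have n1 x y : x \in labels u1 -> nested u2 x y = false /\ nested u2 y x = false.
  by move=> x1; split; apply/negP => /nested_labels[];
    move=> *; apply: (labels_disjoint dis x1).
have n2 x y : x \in labels u2 -> nested u1 x y = false /\ nested u1 y x = false.
  by move=> x1; split; apply/negP => /nested_labels[];
    move=> *; apply: (labels_disjoint dis _ x1).
have l2a x : x \in labels u2 -> (x == a) = false.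
  by move=> x2; apply/eqP => E; move: a2; rewrite -E x2.
have l1a x : x \in labels u1 -> (x == a) = false.
  by move=> x2; apply/eqP => E; move: a1; rewrite -E x2.
rewrite /= mem_cat mem_edges_child; split.
  case/orP => [/orP[/andP[/eqP-> /(mem_root_labels _ uu1)[j1 Hj]]|/(IH1 uu1)[nij Hk]]|/(IH2 uu2)[nij Hk]].
  - rewrite eqxx j1; split=> // k; rewrite na na2 !orbF /=.
    apply/negP=> /andP[k1]; rewrite (l1a _ k1) (negPf (Hj k)) /=.
    by have [-> _] := n1 k j k1.
  - have [i1 j1] := nested_labels nij.
    rewrite nij orbT; split=> // k; rewrite (l1a _ i1) /=.
    have [-> _] := n1 i k i1; have [_ ->] := n1 j k j1; rewrite !orbF.
    apply/negP => /andP[nik]; have [_ k1] := nested_labels nik.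
    by rewrite (l1a _ k1) /= => nkj; have := Hk k; rewrite nik nkj.
  - have [i1 j1] := nested_labels nij.
    rewrite nij !orbT; split=> // k; rewrite (l2a _ i1) /=.
    have [-> _] := n2 i k i1; have [_ ->] := n2 j k j1 => /=.
    apply/negP => /andP[nik]; have [_ k1] := nested_labels nik.
    by rewrite (l2a _ k1) /= => nkj; have := Hk k; rewrite nik nkj.
case=> /or3P[/andP[/eqP-> j1]|nij|nij] Hk.
- rewrite eqxx /=; apply/orP; left; apply/orP; left.
  apply/(mem_root_labels _ uu1); split=> // k; apply/negP => nkj.
  have [k1 _] := nested_labels nkj.
  by have := Hk k; rewrite eqxx k1 nkj orbT.
- apply/orP; left; apply/orP; right; apply/(IH1 uu1); split=> // k.
  by apply/negP => /andP[n1' n2']; have := Hk k; rewrite n1' n2' !orbT.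
- apply/orP; right; apply/(IH2 uu2); split=> // k.
  by apply/negP => /andP[n1' n2']; have := Hk k; rewrite n1' n2' !orbT.
Qed.

(** The positions of the two occurrences of i in the word of u (meaningful when
    the labels are distinct and i is one of them); their recursion matches the
    recursion of the word, which makes the order statements below arithmetic. *)
Fixpoint ends u i : nat * nat :=
  if u is Node a u1 u2 then
    if i == a then (0, (size (word u1)).+1)
    else if i \in labels u1 then ((ends u1 i).1.+1, (ends u1 i).2.+1)
    else ((ends u2 i).1 + (size (word u1)).+2, (ends u2 i).2 + (size (word u1)).+2)
  else (0, 0).

Lemma ends_bounds u i : i \in labels u ->
  (ends u i).1 < (ends u i).2 < size (word u).
Proof.
elim: u => //= a u1 IH1 u2 IH2; rewrite inE mem_cat size_cat /=.
case: eqP => //= _; first by lia.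
case: ifP => /= [/IH1|_ /IH2]; lia.
Qed.

Lemma onth_word u i p : uniq (labels u) -> i \in labels u ->
  (onth (word u) p == Some i) = (p == (ends u i).1) || (p == (ends u i).2).
Proof.
elim: u p => // a u1 IH1 u2 IH2 p.
rewrite uniq_labels_Node => /and5P[a1 a2 uu1 uu2 dis] /=.
have nin (u : forest L) x q : x \notin labels u -> (onth (word u) q == Some x) = false.
  by rewrite -mem_word => /onthPn/(_ q)/negPf.
rewrite inE mem_cat.
case: (eqVneq i a) => [->|ia] /=.
  case: p => [|p] /=; first by rewrite eqxx.
  rewrite /= onth_cat; case: ifP => Hp; first by rewrite nin //; lia.
  case E: (p - size (word u1)) => [|q] /=; first by rewrite eqxx; lia.
  by rewrite nin //; lia.
have neS : (Some a == Some i) = false by apply/eqP => -[E]; rewrite E eqxx in ia.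
case: p => [|p] /=; first by rewrite neS; case: ifP => _ _ /=; lia.
rewrite onth_cat.
case: (boolP (i \in labels u1)) => [i1 _|i1 /= i2] /=.
  have := ends_bounds i1; case: ifP => Hp; first by rewrite IH1; lia.
  move=> Hb; case E: (p - size (word u1)) => [|q] /=; first by rewrite neS; lia.
  rewrite nin; first by lia.
  by apply/negP; apply: labels_disjoint dis i1.
case: ifP => Hp; first by rewrite nin ?i1 //; lia.
case E: (p - size (word u1)) => [|q] /=; first by rewrite neS; lia.
rewrite IH2 //; lia.
Qed.

Lemma nestedE u i j : uniq (labels u) -> i \in labels u -> j \in labels u ->
  nested u i j = ((ends u i).1 < (ends u j).1) && ((ends u j).2 < (ends u i).2).
Proof.
elim: u => // a u1 IH1 u2 IH2.
rewrite uniq_labels_Node => /and5P[a1 a2 uu1 uu2 dis] /=.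
have nn (u : forest L) x y : (x \notin labels u) || (y \notin labels u) -> nested u x y = false.
  by move=> H; apply/negP => /nested_labels[Hx Hy]; rewrite Hx Hy in H.
have dis1 x : x \in labels u1 -> x \notin labels u2.
  by move=> x1; apply/negP; apply: labels_disjoint dis x1.
rewrite !inE !mem_cat.
case: (eqVneq i a) => [->|ia] /=; case: (eqVneq j a) => [->|ja] //=.
- by rewrite (negPf a1) !nn ?a1 ?a2 // ltnn.
- move=> _; case: ifP => /= [j1 _|j1 j2].
    by have := ends_bounds j1; clear IH1 IH2 nn; lia.
  by rewrite !nn ?a1 ?a2 //; clear IH1 IH2 nn; lia.
- by rewrite !nn ?a1 ?a2 ?orbT.
- case: ifP => [i1 _|i1 /= i2]; case: ifP => [j1 _|j1 /= j2] /=.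
  + by rewrite IH1 // (nn u2) ?dis1 //; clear IH1 IH2 nn; lia.
  + rewrite !nn ?j1 ?(dis1 i) ?orbT //.
    by have := ends_bounds i1; clear IH1 IH2 nn; lia.
  + rewrite !nn ?i1 ?(dis1 j) ?orbT //.
    by have := ends_bounds j1; clear IH1 IH2 nn; lia.
  + rewrite (nn u1) ?i1 // IH2 //; clear IH1 IH2 nn; lia.
Qed.

Lemma ends_noncrossing u i j : uniq (labels u) -> i \in labels u -> j \in labels u ->
  ~~ [&& (ends u i).1 < (ends u j).1, (ends u j).1 < (ends u i).2
       & (ends u i).2 < (ends u j).2].
Proof.
elim: u => // a u1 IH1 u2 IH2.
rewrite uniq_labels_Node => /and5P[a1 a2 uu1 uu2 dis] /=.
rewrite !inE !mem_cat.
case: (eqVneq i a) => [->|ia] /=; case: (eqVneq j a) => [->|ja] /=; try (clear IH1 IH2; lia).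
- move=> _; case: ifP => /= [j1 _|j1 j2]; last by clear IH1 IH2; lia.
  by have := ends_bounds j1; clear IH1 IH2; lia.
- case: ifP => [i1 _|i1 /= i2]; case: ifP => [j1 _|j1 /= j2] /=.
  + exact: IH1.
  + by have := ends_bounds i1; clear IH1 IH2; lia.
  + by have := ends_bounds j1; clear IH1 IH2; lia.
  + by rewrite !ltn_add2r; apply: IH2.
Qed.

Definition noncrossing_word (s : seq L) :=
  forall a b, a != b -> ~~ subseq [:: a; b; a; b] s.

(** The parsing of words: write the word as a s1 a s2.  A letter b common to s1
    and s2 would produce the crossing a b a b, so both copies of each letter
    lie on the same side and s1, s2 are again words of this kind. *)
Lemma word_of_noncrossing (s : seq L) :
    (forall i, i \in s -> count_mem i s = 2) -> noncrossing_word s ->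
  exists u, word u = s.
Proof.
have [m] := ubnP (size s); elim: m s => // m IHm [|a s] /= Hm cnt nc.
  by exists Empty.
have as_ : a \in s.
  have := cnt a (mem_head _ _); rewrite /= eqxx -has_pred1 has_count; lia.
case/splitPr: as_ Hm cnt nc => s1 s2; rewrite size_cat /= => Hm cnt nc.
have ca : count_mem a s1 = 0 /\ count_mem a s2 = 0.
  have := cnt a (mem_head _ _); rewrite /= count_cat /= eqxx; lia.
have ca1 : a \notin s1 by apply/count_memPn; case: ca.
have ca2 : a \notin s2 by apply/count_memPn; case: ca.
have dis b : b \in s1 -> b \in s2 -> False.
  move=> b1 b2; have ab : a != b by apply: contraNneq ca1 => ->.
  have /negP[] := nc a b ab.
  apply: (@cat_subseq _ [:: a; b] [:: a; b] (a :: s1) (a :: s2)).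
    by rewrite /= eqxx sub1seq.
  by rewrite /= eqxx sub1seq.
have [|i i1||u1 E1] := IHm s1; first by lia.
- have ia : i != a by apply: contraNneq ca1 => <-.
  have := cnt i; rewrite inE mem_cat i1 orbT /= count_cat /= eq_sym (negPf ia) => /(_ isT).
  have /count_memPn -> : i \notin s2 by apply/negP; apply: dis.
  lia.
- move=> x y xy; apply: contra (nc x y xy) => /subseq_trans; apply.
  by apply: subseq_trans (subseq_cons _ _); apply: prefix_subseq.
have [|i i1||u2 E2] := IHm s2; first by lia.
- have ia : i != a by apply: contraNneq ca2 => <-.
  have := cnt i; rewrite !inE mem_cat inE i1 !orbT /= count_cat /= eq_sym (negPf ia) => /(_ isT).
  have /count_memPn -> : i \notin s1 by apply/negP => /dis; apply.
  lia.
- move=> x y xy; apply: contra (nc x y xy) => /subseq_trans; apply.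
  apply: subseq_trans (subseq_cons _ _); apply: subseq_trans (suffix_subseq _ _).
  exact: subseq_cons.
by exists (Node a u1 u2); rewrite /= E1 E2.
Qed.

End Nesting.

(** * Exhaustive lists of forests *)

Section Enumeration.
Variable L : finType.

(** Bounding the height keeps the two subforests of a node independent: no
    relation between their sizes has to be maintained. *)
Fixpoint forests_upto k : seq (forest L) :=
  if k is k'.+1 then
    Empty :: [seq Node s.1 s.2 v | s <- [seq (a, u) | a <- enum L, u <- forests_upto k'],
                                   v <- forests_upto k']
  else [:: Empty].

Definition trees_upto k := [seq (a, u) | a <- enum L, u <- forests_upto k].

Lemma uniq_forests_upto k : uniq (forests_upto k).
Proof.
elim: k => //= k IHk; apply/andP; split.
  by apply/allpairsP => -[[s v] []].
apply: allpairs_uniq => //.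
  by apply: allpairs_uniq; rewrite ?enum_uniq // => -[] ? ? [].
by move=> [[a u] v] [[b u'] v'] _ _ [-> -> ->].
Qed.

Lemma mem_forests_upto k (u : forest L) : size (labels u) <= k -> u \in forests_upto k.
Proof.
elim: k u => [|k IHk] [|a u v] //=; rewrite inE //= size_cat => Hs.
apply/allpairsP; exists ((a, u), v) => /=; split=> //; last by apply: IHk; lia.
by apply/allpairsP; exists (a, u); rewrite /= mem_enum; split=> //; apply: IHk; lia.
Qed.

End Enumeration.

(** * The pairing of a labelled forest *)

Section Matching.
Variable n : nat.
Implicit Types (u : forest 'I_n) (i j : 'I_n) (P : n.-tuple {set 'I_(2 * n)}).

Definition block u i : {set 'I_(2 * n)} := [set p | onth (word u) (val p) == Some i].

Definition matching u : n.-tuple {set 'I_(2 * n)} := [tuple block u i | i < n].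

Definition full u : bool := perm_eq (labels u) (enum 'I_n).

Lemma tnth_matching u i : tnth (matching u) i = block u i.
Proof. by rewrite tnth_mktuple. Qed.

Lemma mem_matching u B : (B \in matching u) <-> exists i, B = block u i.
Proof.
split; first by case/tnthP => i ->; exists i; rewrite tnth_matching.
by case=> i ->; rewrite -tnth_matching mem_tnth.
Qed.

Section Full.
Variable u : forest 'I_n.
Hypothesis full_u : full u.

Lemma full_uniq : uniq (labels u).
Proof. by rewrite (perm_uniq full_u) enum_uniq. Qed.

Lemma full_mem i : i \in labels u.
Proof. by rewrite (perm_mem full_u) mem_enum. Qed.

Lemma full_size : size (word u) = 2 * n.
Proof. by rewrite size_word (perm_size full_u) size_enum_ord mul2n. Qed.

Let U := full_uniq.
Let M := full_mem.

Lemma lo_lt i : (ends u i).1 < 2 * n.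
Proof. have := ends_bounds (M i); rewrite full_size; lia. Qed.

Lemma hi_lt i : (ends u i).2 < 2 * n.
Proof. have := ends_bounds (M i); rewrite full_size; lia. Qed.

Definition lo i : 'I_(2 * n) := Ordinal (lo_lt i).
Definition hi i : 'I_(2 * n) := Ordinal (hi_lt i).

Lemma loE i : (ends u i).1 = lo i. Proof. by []. Qed.
Lemma hiE i : (ends u i).2 = hi i. Proof. by []. Qed.

Lemma lo_lt_hi i : lo i < hi i.
Proof. by have /andP[] := ends_bounds (M i). Qed.

Lemma blockE i : block u i = [set lo i; hi i].
Proof. by apply/setP => p; rewrite !inE onth_word. Qed.

Lemma block_disjoint i j p : p \in block u i -> p \in block u j -> i = j.
Proof. by rewrite !inE => /eqP -> /eqP[]. Qed.

Lemma block_inj : injective (block u).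
Proof.
by move=> i j E; apply: (@block_disjoint _ _ (lo i)); rewrite -?E blockE !inE eqxx.
Qed.

Lemma card_block i : #|block u i| = 2.
Proof. by rewrite blockE cards2 -val_eqE neq_ltn lo_lt_hi. Qed.

Lemma block_ltE i j : block_lt (block u i) (block u j) = nested u i j.
Proof.
rewrite nestedE // !loE !hiE.
have Hi := lo_lt_hi i; have Hj := lo_lt_hi j.
apply/andP/andP => [[ne /exists_inP[a Ha /exists_inP[b Hb /forall_inP H]]]|[H1 H2]].
  have := H (lo j); have := H (hi j); rewrite blockE !inE !eqxx orbT => /(_ isT) h1 /(_ isT) h2.
  move: Ha Hb h1 h2; rewrite !blockE !inE.
  by case/orP => /eqP-> /orP[] /eqP->; rewrite /= in Hi Hj *; lia.
split.
  by apply/eqP => /block_inj E; rewrite E ltnn in H1.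
apply/exists_inP; exists (lo i); first by rewrite blockE !inE eqxx.
apply/exists_inP; exists (hi i); first by rewrite blockE !inE eqxx orbT.
apply/forall_inP => c; rewrite blockE !inE => /orP[] /eqP->; rewrite /= in Hi Hj H1 H2 *; lia.
Qed.

Lemma block_coverE i j :
  block_cover [set B in matching u] (block u i) (block u j) = ((i, j) \in edges None u).
Proof.
apply/andP/idP.
  case; rewrite block_ltE => nij H; apply/mem_edges => //; split=> // k.
  apply: contra H => nn; apply/exists_inP; exists (block u k); last by rewrite !block_ltE.
  by rewrite inE; apply/mem_matching; exists k.
case/mem_edges => // nij H; rewrite block_ltE; split=> //.
apply/exists_inP => -[B]; rewrite inE => /mem_matching[k ->].
by rewrite !block_ltE; apply/negP.
Qed.

Lemma uniq_targets : uniq [seq e.2 | e <- edges None u].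
Proof.
have : subseq [seq e.2 | e <- edges None u] (labels u).
  elim: (u) => //= a u1 _ u2 IH2; rewrite map_cat targets_child.
  by apply: subseq_trans (subseq_cons _ _); apply: cat_subseq.
by move/subseq_uniq; apply.
Qed.

Lemma uniq_edges : uniq (edges None u).
Proof. exact: map_uniq uniq_targets. Qed.

Lemma edges_irr e : e \in edges None u -> e.1 != e.2.
Proof.
case: e => i j /mem_edges[] //; rewrite nestedE // => /andP[+ _] _ /=.
by apply: contraTneq => ->; rewrite ltnn.
Qed.

Lemma orders_matching :
  orders (matching u) = count (fun e : 'I_n * 'I_n => e.1 < e.2) (edges None u).
Proof.
rewrite -size_filter; set s := filter _ _.
have us : uniq s by rewrite filter_uniq // uniq_edges.
rewrite -(card_uniqP us); apply: eq_card => -[i j].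
by rewrite inE /= !tnth_matching block_coverE mem_filter.
Qed.

Lemma disorders_matching :
  disorders (matching u) = count (fun e : 'I_n * 'I_n => e.2 < e.1) (edges None u).
Proof.
rewrite -size_filter; set s := filter _ _.
have us : uniq s by rewrite filter_uniq // uniq_edges.
pose sw (e : 'I_n * 'I_n) := (e.2, e.1).
have us' : uniq (map sw s) by rewrite map_inj_uniq // => -[? ?] [? ?] [-> ->].
rewrite -(size_map sw) -(card_uniqP us'); apply: eq_card => -[i j].
rewrite inE /= !tnth_matching block_coverE.
apply/andP/mapP => [[ij eij]|[[i' j']]]; last by rewrite mem_filter => /= /andP[? ?] [-> ->].
by exists (j, i); rewrite ?mem_filter //= ij.
Qed.

(** Every edge joins two distinct labels, so it counts for exactly one of the
    two statistics. *)
Lemma orders_disorders :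
  disorders (matching u) + orders (matching u) = size (edges None u).
Proof.
rewrite disorders_matching orders_matching -(count_predC (fun e : 'I_n * 'I_n => e.2 < e.1)).
congr (_ + _); apply: eq_in_count => e /edges_irr /=.
by rewrite -val_eqE neq_ltn -leqNgt; case: ltngtP.
Qed.

(** Among the blocks around block j, the one that opens last covers it. *)
Lemma has_parent j k : nested u k j -> exists i, (i, j) \in edges None u.
Proof.
move=> nkj; pose S := [pred i | nested u i j].
case: (@arg_maxnP _ k S (fun i => (ends u i).1) nkj) => i ni Hmax.
exists i; apply/mem_edges => //; split=> // m; apply/negP => /andP[nim nmj].
have := Hmax m nmj; move: nim; rewrite nestedE // => /andP[] /=; lia.
Qed.

(** Inner blocks are the blocks with a parent, and edges are determined by their
    lower end. *)
Lemma inner_matching : #|inner_blocks [set B in matching u]| = size (edges None u).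
Proof.
rewrite -(size_map snd) -(card_uniqP uniq_targets) -(card_imset _ block_inj).
apply: eq_card => B; rewrite !inE; apply/andP/imsetP.
  case=> /mem_matching[j ->{B}] /exists_inP[B].
  rewrite inE => /mem_matching[k ->]; rewrite block_ltE => /has_parent[i ij].
  by exists j => //; apply/mapP; exists (i, j).
case=> j /mapP[[i j'] ij /= ->] -> {j B}; split; first by apply/mem_matching; exists j'.
apply/exists_inP; exists (block u i); first by rewrite inE; apply/mem_matching; exists i.
by rewrite block_ltE; case/mem_edges: ij.
Qed.

Lemma matching_ONC2 : matching u \in ONC2 n.
Proof.
rewrite inE; apply/andP; split.
  rewrite map_inj_uniq ?enum_uniq //; exact: block_inj.
have blk B : (B \in [set B in matching u]) <-> exists i, B = block u i.
  by rewrite inE; exact: mem_matching.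
rewrite inE; apply/and3P; split.
- apply/and3P; split.
  + apply/eqP/setP => p; rewrite [RHS]inE; apply/bigcupP.
    have : onth (word u) p by rewrite onthTE full_size.
    case E: (onth _ _) => [i|] // _; exists (block u i); last by rewrite inE E.
    by apply/blk; exists i.
  + apply/trivIsetP => A B /blk[i ->] /blk[j ->] ne.
    rewrite -setI_eq0; apply/set0Pn => -[p]; rewrite inE => /andP[pi pj].
    by rewrite (block_disjoint pi pj) eqxx in ne.
  + apply/negP => /blk[i E]; by have := card_block i; rewrite -E cards0.
- apply/forall_inP => A /blk[i ->]; apply/forall_inP => B /blk[j ->]; apply/implyP => ne.
  apply/exists_inP => -[k Ak /exists_inP[m Bm /exists_inP[k' Ak' /exists_inP[m' Bm']]]].
  have := ends_noncrossing U (M i) (M j).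
  rewrite !loE !hiE.
  have := lo_lt_hi i; have := lo_lt_hi j; move: Ak Bm Ak' Bm'.
  move: (lo i) (hi i) (lo j) (hi j) (blockE i) (blockE j) => a b c d -> ->; clear.
  rewrite !inE.
by do 4!(case/orP => /eqP->); move=> H1 H2 H3 /and3P[H4 H5 H6]; lia.
- by apply/forall_inP => A /blk[i ->]; rewrite card_block.
Qed.

End Full.

Lemma matching_inj u v : full u -> full v -> matching u = matching v -> u = v.
Proof.
move=> fu fv E; apply: word_inj_uniq; first exact: full_uniq.
have bE i : block u i = block v i by rewrite -!tnth_matching E.
apply: eq_from_onth_le => p; rewrite !full_size // maxnn => Hp.
have : onth (word u) p by rewrite onthTE full_size.
case Ep: (onth (word u) p) => [i|] // _.
have : Ordinal Hp \in block u i by rewrite inE /= Ep.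
by rewrite bE inE /= => /eqP.
Qed.

(** Reading off at each position the index of its block gives a word in which
    each index occurs twice and no pattern a b a b occurs; it is then parsed. *)
Lemma matching_surj P : P \in ONC2 n -> exists2 u, full u & matching u = P.
Proof.
rewrite !inE => /andP[uP /and3P[/and3P[/eqP covP trP _] ncP /forall_inP cardP]].
have mP i : tnth P i \in [set B in P] by rewrite inE mem_tnth.
have injP i j : tnth P i = tnth P j -> i = j by move/tuple_uniqP: uP; apply.
have disP i j p : p \in tnth P i -> p \in tnth P j -> i = j.
  move=> pi pj; apply: contraTeq pj => ne.
  have /(disjointFr)-> // := trivIsetP trP _ _ (mP i) (mP j) (contra_neq (@injP i j) ne).
have /fin_all_exists[f Pf] (p : 'I_(2 * n)) : exists i, p \in tnth P i.
  have : p \in cover [set B in P] by rewrite covP inE.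
  by case/bigcupP => B; rewrite inE => /tnthP[i ->]; exists i.
have fE p i : (f p == i) = (p \in tnth P i).
  apply/eqP/idP => [<- //|]; exact: disP.
pose s := [seq f p | p <- enum 'I_(2 * n)].
have cnt i : count_mem i s = 2.
  rewrite count_map; transitivity #|tnth P i|; last exact/eqP/cardP.
  rewrite cardE /enum_mem size_filter count_filter.
  by apply: eq_count => p /=; rewrite fE andbT.
have [||u Eu] := @word_of_noncrossing _ s.
- by move=> i _; apply: cnt.
- move=> a b ab; apply/negP => /subseqP[m Hm]; rewrite /s -map_mask.
  (* t lists the four positions carrying the pattern, in increasing order. *)
  set t := mask m _ => E.
  have : size t = 4 by have := congr1 size E; rewrite size_map.
  have : subseq (map val t) (map val (enum 'I_(2 * n))) by rewrite map_subseq // mask_subseq.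
  rewrite val_enum_ord => /(subseq_sorted ltn_trans)/(_ (iota_ltn_sorted 0 _)).
  case: (t) E => [|p [|q [|r [|x [|? ?]]]]] //= [Ep Eq Er Ex] /and4P[pq qr rx _] _.
  have /forall_inP/(_ _ (mP b))/implyP := forall_inP ncP _ (mP a).
  case/(_ (contra_neq (@injP a b) ab))/exists_inP; exists p; first by rewrite -fE Ep.
  apply/exists_inP; exists q; first by rewrite -fE Eq.
  apply/exists_inP; exists r; first by rewrite -fE Er.
  apply/exists_inP; exists x; first by rewrite -fE Ex.
  by rewrite pq qr rx.
have cntl i : count_mem i (labels u) = 1.
  by apply: double_inj; rewrite -count_word Eu cnt.
exists u.
  apply/allP => i _ /=; rewrite cntl count_uniq_mem ?enum_uniq // mem_enum //.
apply: eq_from_tnth => i; rewrite tnth_matching; apply/setP => p.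
rewrite inE Eu /s onth_map -fE.
have -> : onth (enum 'I_(2 * n)) p = Some p.
  by rewrite onthE (nth_map p) ?size_enum_ord // nth_ord_enum.
by rewrite /=; apply/eqP/eqP => [[]|->].
Qed.

Lemma perm_matchings :
  perm_eq (enum (ONC2 n)) [seq matching u | u <- forests_upto 'I_n n & full u].
Proof.
apply: uniq_perm; first exact: enum_uniq.
  rewrite map_inj_in_uniq ?filter_uniq ?uniq_forests_upto // => u v.
  by rewrite !mem_filter => /andP[fu _] /andP[fv _]; apply: matching_inj.
move=> P; rewrite mem_enum; apply/idP/mapP.
  case/matching_surj => u fu <-; exists u => //; rewrite mem_filter fu.
  by apply: mem_forests_upto; rewrite (perm_size fu) size_enum_ord.
by case=> u; rewrite mem_filter => /andP[fu _] ->; apply: matching_ONC2.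
Qed.

Lemma card_orderings (T : finType) (A : {set T}) m : #|A| = m ->
  #|[set t : m.-tuple T | uniq t && ([set x in t] == A)]| = m`!.
Proof.
move=> cA; rewrite -ffactnn -[X in X ^_ _]cA -card_uniq_tuples.
apply: eq_card => t; rewrite !inE andbC; apply/andP/andP => -[H ut]; split=> //.
  apply/allP => x xt; have : x \in [set y in t] by rewrite inE.
  by rewrite (eqP H).
rewrite eqEcard cA cardsE (card_uniqP ut) size_tuple leqnn andbT.
by apply/subsetP => x; rewrite inE; apply: (allP H).
Qed.

Lemma card_NC2 (pi : {set {set 'I_(2 * n)}}) : pi \in NC2 n -> #|pi| = n.
Proof.
rewrite inE => /and3P[pP _ /forall_inP c].
have := card_uniform_partition (fun A HA => eqP (c A HA)) pP.
by rewrite cardsT card_ord; lia.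
Qed.

End Matching.

(** * Averaging the comparisons along the edges *)

Import GRing.Theory.

Section WeightedSums.
Local Open Scope ring_scope.
Variables (R : idomainType) (L : finType) (w : L -> L -> R) (c : R).
Hypothesis two_neq0 : 2%:R != 0 :> R.
(** The average of the weights of an edge and of the reversed edge is c.  The case
    a = b amounts to w a a = c, which makes the symmetry hold for forests with
    repeated labels too. *)
Hypothesis w_sym : forall a b, w a b + w b a = 2%:R * c.

Definition weight p (u : forest L) : R := \prod_(e <- edges p u) w e.1 e.2.

Definition tree_labels (t : L * forest L) := t.1 :: labels t.2.

Lemma weight_Node p b u1 u2 :
  weight p (Node b u1 u2) =
    (if p is Some a then w a b else 1) * weight (Some b) u1 * weight p u2.
Proof.
by rewrite /weight /=; case: p => [a|]; rewrite /= ?big_cons big_cat /= ?mul1r -?mulrA //.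
Qed.

Lemma weight_Empty p : weight p Empty = 1.
Proof. by rewrite /weight big_nil. Qed.

(** Exchanging s and t permutes the pairs and keeps H, so the sum is unchanged
    when the weight is replaced by its average over the two orders. *)
Lemma sum_symmetric_pairs (I : Type) (r : seq I) (root : I -> L) (H : I -> I -> R) :
    (forall s t, H s t = H t s) ->
  \sum_(s <- r) \sum_(t <- r) w (root t) (root s) * H s t =
    c * \sum_(s <- r) \sum_(t <- r) H s t.
Proof.
move=> Hsym; apply: (mulfI two_neq0); rewrite mulrA.
rewrite {1}mulr_natl mulr2n {2}exchange_big /= -big_split /= mulr_sumr.
apply: eq_bigr => s _; rewrite -big_split /= mulr_sumr.
by apply: eq_bigr => t _; rewrite (Hsym t s) -mulrDl w_sym.
Qed.

Lemma sum_forests_succ k (f : forest L -> R) :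
  \sum_(u <- forests_upto L k.+1) f u =
    f Empty + \sum_(s <- trees_upto L k) \sum_(v <- forests_upto L k) f (Node s.1 s.2 v).
Proof. by rewrite big_cons (big_allpairs_dep (h := fun s v => Node s.1 s.2 v)). Qed.

(** The cut of the edge from the root to its first child: a tree of more than
    one vertex amounts to an ordered pair of trees, s containing the child and t
    the root. *)
Lemma sum_trees_succ k (f : L * forest L -> R) :
  \sum_(t <- trees_upto L k.+1) f t =
    \sum_a f (a, Empty)
    + \sum_(s <- trees_upto L k) \sum_(t <- trees_upto L k) f (t.1, Node s.1 s.2 t.2).
Proof.
rewrite big_allpairs big_enum /=.
under eq_bigr do rewrite sum_forests_succ.
rewrite big_split /=; congr (_ + _); rewrite exchange_big /=.
by apply: eq_bigr => s _; rewrite [RHS]big_allpairs big_enum.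
Qed.

(** By induction, cutting the first edge at the root and averaging its weight
    over the exchange of the two parts.  The factor mu must be allowed to vary
    in the induction: when one of the two trees of a pair is fixed, mu of the
    labels of both is a factor for the other tree. *)
Lemma sum_tree_weights k (mu : seq L -> R) :
    (forall s t, perm_eq s t -> mu s = mu t) ->
  \sum_(t <- trees_upto L k) weight (Some t.1) t.2 * mu (tree_labels t) =
    \sum_(t <- trees_upto L k) c ^+ size (labels t.2) * mu (tree_labels t).
Proof.
elim: k mu => [|k IHk] mu mu_perm.
  rewrite /trees_upto !big_allpairs; apply: eq_bigr => a _.
  by rewrite !big_seq1 weight_Empty expr0.
rewrite !sum_trees_succ; congr (_ + _).
  by apply: eq_bigr => a _; rewrite weight_Empty expr0.
pose H (e : L * forest L -> R) s t := e s * e t * mu (tree_labels s ++ tree_labels t).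
have relabel s t : mu (tree_labels (t.1, Node s.1 s.2 t.2))
    = mu (tree_labels s ++ tree_labels t).
  apply: mu_perm; apply/permPl.
  exact: (perm_catCA [:: t.1] (tree_labels s) (labels t.2)).
transitivity (\sum_(s <- trees_upto L k) \sum_(t <- trees_upto L k)
    w t.1 s.1 * H (fun t => weight (Some t.1) t.2) s t).
  apply: eq_bigr => s _; apply: eq_bigr => t _.
  by rewrite relabel weight_Node /H !mulrA.
rewrite sum_symmetric_pairs; last first.
  move=> s t; rewrite /H (mulrC (weight _ _)); congr (_ * _).
  by apply: mu_perm; rewrite perm_catC.
transitivity (c * \sum_(s <- trees_upto L k) \sum_(t <- trees_upto L k)
    H (fun t => c ^+ size (labels t.2)) s t).
  congr (_ * _).
  transitivity (\sum_(s <- trees_upto L k) \sum_(t <- trees_upto L k)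
      weight (Some s.1) s.2 * (c ^+ size (labels t.2)
        * mu (tree_labels s ++ tree_labels t))).
    apply: eq_bigr => s _; rewrite -mulr_sumr -(IHk (fun l => mu (tree_labels s ++ l))).
      by rewrite mulr_sumr; apply: eq_bigr => t _; rewrite /H mulrA.
    by move=> l1 l2 Hl; apply: mu_perm; rewrite perm_cat2l.
  rewrite exchange_big /= [RHS]exchange_big /=; apply: eq_bigr => t _.
  transitivity (c ^+ size (labels t.2) * \sum_(s <- trees_upto L k)
      weight (Some s.1) s.2 * mu (tree_labels s ++ tree_labels t)).
    by rewrite mulr_sumr; apply: eq_bigr => s _; rewrite mulrCA.
  rewrite (IHk (fun l => mu (l ++ tree_labels t))); last first.
    by move=> l1 l2 Hl; apply: mu_perm; rewrite perm_cat2r.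
  by rewrite mulr_sumr; apply: eq_bigr => s _; rewrite /H mulrCA mulrA.
rewrite mulr_sumr; apply: eq_bigr => s _; rewrite mulr_sumr.
apply: eq_bigr => t _; rewrite relabel /H /= size_cat exprS exprD.
by rewrite !mulrA.
Qed.

(** The factor nu also sees the number of edges, because in a forest this
    number is not determined by the number of labels. *)
Lemma sum_forest_weights k (nu : nat -> seq L -> R) :
    (forall i s t, perm_eq s t -> nu i s = nu i t) ->
  \sum_(u <- forests_upto L k) weight None u * nu (size (edges None u)) (labels u) =
  \sum_(u <- forests_upto L k)
    c ^+ size (edges None u) * nu (size (edges None u)) (labels u).
Proof.
elim: k nu => [|k IHk] nu nu_perm.
  by rewrite !big_seq1 weight_Empty expr0.
rewrite !sum_forests_succ weight_Empty expr0; congr (_ + _).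
have nuE s v : nu (size (edges None (Node s.1 s.2 v))) (labels (Node s.1 s.2 v)) =
    nu (size (labels s.2) + size (edges None v))%N (tree_labels s ++ labels v).
  by rewrite /= size_cat size_edges_child.
transitivity (\sum_(s <- trees_upto L k) \sum_(v <- forests_upto L k)
   weight (Some s.1) s.2 * (c ^+ size (edges None v) *
    nu (size (labels s.2) + size (edges None v))%N (tree_labels s ++ labels v))).
  apply: eq_bigr => s _; rewrite -mulr_sumr.
  rewrite -(IHk (fun i l => nu (size (labels s.2) + i)%N (tree_labels s ++ l))).
    by rewrite mulr_sumr; apply: eq_bigr => v _; rewrite nuE weight_Node mul1r mulrA.
  by move=> i l1 l2 Hl; apply: nu_perm; rewrite perm_cat2l.
rewrite exchange_big /= [RHS]exchange_big /=; apply: eq_bigr => v _.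
(* A tree with label list l has one edge less than it has labels. *)
pose mu l := nu ((size l).-1 + size (edges None v))%N (l ++ labels v).
transitivity (c ^+ size (edges None v) * \sum_(s <- trees_upto L k)
    weight (Some s.1) s.2 * mu (tree_labels s)).
  by rewrite mulr_sumr; apply: eq_bigr => s _; rewrite mulrCA.
rewrite sum_tree_weights; last first.
  move=> l1 l2 Hl; rewrite /mu (perm_size Hl); apply: nu_perm.
  by rewrite perm_cat2r.
rewrite mulr_sumr; apply: eq_bigr => s _.
by rewrite nuE /= size_cat size_edges_child exprD mulrA (mulrC (c ^+ _)).
Qed.

End WeightedSums.

(** * Counting ordered pairings by orders and disorders *)

Local Open Scope ring_scope.

Definition inner_count n (P : n.-tuple {set 'I_(2 * n)}) : nat :=
  #|inner_blocks [set B in P]|.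

(** Every pairing of [2n] has n blocks, hence n! orderings. *)
Lemma card_ONC2_inner n l :
  #|[set P in ONC2 n | inner_count P == l]| = (n`! * delaney_number n l)%N.
Proof.
rewrite -sum1_card (partition_big (fun P : n.-tuple _ => [set B in P])
  (mem [set pi in NC2 n | #|inner_blocks pi| == l])) /=; last first.
  by move=> P; rewrite !inE => /andP[/andP[_ ->]].
rewrite [RHS]mulnC -sum_nat_const; apply: eq_bigr => pi Hpi.
have [pi2 /eqP il] : pi \in NC2 n /\ #|inner_blocks pi| == l.
  by move: Hpi; rewrite inE => /andP[].
rewrite -(card_orderings (card_NC2 pi2)) -sum1_card; apply: eq_bigl => P.
rewrite !inE /inner_count; case: (eqVneq [set B in P] pi) => [->|_]; last by rewrite !andbF.
by rewrite il eqxx !andbT; move: pi2; rewrite inE => ->; rewrite andbT.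
Qed.

Definition mean_weight : {poly rat} := (2%:R^-1)%:P * ('X + 1).

(** The variable marks ascents, that is the pairs counted by orders.  Equal
    labels get the mean weight so that the symmetry below has no exception. *)
Definition comparison_weight n (i j : 'I_n) : {poly rat} :=
  if (i < j)%N then 'X else if (j < i)%N then 1 else mean_weight.

Lemma comparison_weight_sym n (i j : 'I_n) :
  comparison_weight i j + comparison_weight j i = 2%:R * mean_weight.
Proof.
have E : 2%:R * mean_weight = 'X + 1.
  by rewrite /mean_weight mulrA -polyC_natr -polyCM divff ?mul1r.
rewrite /comparison_weight; case: (ltngtP i j) => _; rewrite E //.
  by rewrite addrC.
by rewrite -E mulr_natl mulr2n.
Qed.

Lemma coef_mean_weight l j :
  (mean_weight ^+ l)`_j = 2%:R ^- l * ('C(l, j))%:R.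
Proof.
rewrite exprMn -rmorphXn /= coefCM exprVn; congr (_ * _).
rewrite exprD1n coef_sum.
have [jl|lj] := leqP j l.
  rewrite (bigD1 (Ordinal (jl : (j < l.+1)%N))) //= coefMn coefXn eqxx big1 ?addr0 //.
  by move=> i; rewrite -val_eqE /= => ij; rewrite coefMn coefXn eq_sym (negPf ij) mul0rn.
rewrite bin_small // big1 // => i _; rewrite coefMn coefXn.
by rewrite gtn_eqF ?mul0rn //; apply: leq_trans (ltn_ord i) lj.
Qed.

Lemma weight_full n (u : forest 'I_n) : full u ->
  weight (@comparison_weight n) None u = 'X^(orders (matching u)).
Proof.
move=> fu; rewrite (orders_matching fu) /weight.
have := @edges_irr _ _ fu; elim: (edges None u) => [|e s IHs] H.
  by rewrite big_nil expr0.
rewrite big_cons IHs; last by move=> e' He'; apply: H; rewrite inE He' orbT.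
have := H e (mem_head _ _); rewrite -val_eqE /comparison_weight /= exprD.
by case: ltngtP => // _ _; rewrite ?expr1 ?expr0.
Qed.

Lemma sum_ONC2_inner n l (f : n.-tuple {set 'I_(2 * n)} -> {poly rat}) :
  \sum_(P in [set P in ONC2 n | inner_count P == l]) f P =
    \sum_(u <- forests_upto 'I_n n)
      if full u && (size (edges None u) == l) then f (matching u) else 0.
Proof.
transitivity (\sum_(P <- enum (ONC2 n)) if inner_count P == l then f P else 0).
  by rewrite big_enum /= -big_mkcondr; apply: eq_bigl => P; rewrite inE.
rewrite (perm_big _ (perm_matchings n)) /= big_map big_filter big_mkcond.
apply: eq_bigr => u _; case: ifP => //= fu.
by rewrite /inner_count inner_matching.
Qed.

(** On the set of ordered pairings with l inner blocks, the number of orders is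
    distributed as the number of heads among l fair coins. *)
Lemma orders_polynomial n l :
  \sum_(P in [set P in ONC2 n | inner_count P == l]) 'X^(orders P) =
    mean_weight ^+ l * (n`! * delaney_number n l)%:R.
Proof.
pose nu i s : {poly rat} := if perm_eq s (enum 'I_n) && (i == l) then 1 else 0.
have nu_perm i s t : perm_eq s t -> nu i s = nu i t.
  by move=> st; rewrite /nu (permPl st).
have two_neq0 : 2%:R != 0 :> {poly rat} by rewrite -polyC_natr polyC_eq0.
have := sum_forest_weights two_neq0 (@comparison_weight_sym n) n nu_perm.
rewrite sum_ONC2_inner => E.
transitivity (\sum_(u <- forests_upto 'I_n n)
    weight (@comparison_weight n) None u * nu (size (edges None u)) (labels u)).
  apply: eq_bigr => u _; rewrite /nu -/(full u).
  case: (boolP (full u)) => fu /=; last by rewrite mulr0.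
  by rewrite weight_full //; case: eqP; rewrite ?mulr1 ?mulr0.
rewrite E -card_ONC2_inner -sum1_card natr_sum sum_ONC2_inner mulr_sumr.
apply: eq_bigr => u _; rewrite /nu -/(full u).
by case: ifP => [/andP[_ /eqP->]|]; rewrite ?mulr0.
Qed.

(** Orders and disorders add up to the number of inner blocks, so the pair of
    conditions can be traded for one on inner blocks and one on orders. *)
Lemma euler_number_inner n k j :
  euler_number n k j =
    #|[set P in [set P in ONC2 n | inner_count P == (k + j)%N] | orders P == j]|.
Proof.
rewrite /euler_number !setIdE -setIA; apply: eq_card => P; rewrite !in_setI.
case: (boolP (P \in ONC2 n)) => //= /matching_surj[u fu <-].
rewrite !in_set /inner_count inner_matching // -(orders_disorders fu).
by rewrite andbC [RHS]andbC; case: eqP => //= ->; rewrite eqn_add2r.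
Qed.

Theorem proposition3p5 (n k j : nat) (hn : (1 <= n)%N)
    (hk : (k <= n - 1)%N) (hj : (j <= n - 1)%N) :
  (euler_number n k j)%:R =
    (n`!)%:R / 2%:R ^+ (k + j) * ('C(k + j, k))%:R
      * (delaney_number n (k + j))%:R :> rat.
Proof.
have := congr1 (fun p : {poly rat} => p`_j) (orders_polynomial n (k + j)).
rewrite /= mulr_natr coefMn coef_mean_weight -[_ *+ (_ * _)]mulr_natr natrM coef_sum => E.
have -> : (euler_number n k j)%:R =
    \sum_(P in [set P in ONC2 n | inner_count P == (k + j)%N])
       ('X^(orders P) : {poly rat})`_j :> rat.
  rewrite euler_number_inner -sum1_card natr_sum.
  under eq_bigl do rewrite inE.
  rewrite big_mkcondr; apply: eq_bigr => P _.
  by rewrite coefXn eq_sym; case: eqP.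
rewrite E -(bin_sub (leq_addl k j)) addnK.
by ring.
Qed.
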